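(* For every positive integer $n$ there is a constant $c_n>0$ such that for every number field $K$ of degree $n$, the largest ($n$-th) successive minimum of the lattice $\mathcal{O}_K\subset\mathbb{R}^n$ has length at most $c_n\,|\mathrm{Disc}(K)|^{1/n}$; equivalently, $\mathcal{O}_K$ contains $n$ linearly independent elements each of Euclidean length at most $c_n|\mathrm{Disc}(K)|^{1/n}$.
   Context: $\mathcal{O}_K$ is the ring of integers of $K$ and $\mathrm{Disc}(K)$ its absolute discriminant. If $K$ has $r$ real embeddings and $s$ pairs of complex conjugate embeddings, then $\mathcal{O}_K$ is viewed as a lattice in $\mathbb{R}^n=\mathbb{R}^r\times\mathbb{C}^s$ via its archimedean embeddings up to complex conjugation, with $\mathbb{C}$ identified with $\mathbb{R}^2$ in the usual way and $\mathbb{R}^n$ given the Euclidean length. *)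

(* Defs.v *)
From HB Require Import structures.
From mathcomp Require Import all_boot all_order all_algebra all_field.
From mathcomp Require Import complex.
From mathcomp Require Import all_classical all_reals all_analysis.

Set Implicit Arguments.
Unset Strict Implicit.
Unset Printing Implicit Defensive.

Import Order.TTheory GRing.Theory Num.Theory.
Local Open Scope classical_set_scope.
Local Open Scope ring_scope.

Section NumberField.
Variable K : fieldExtType rat.

Definition ring_of_integers : set K :=
  [set x | integralOver (intr : int -> K) x].

Definition field_trace (x : K) : rat :=
  \tr (passmx.mxof (vbasis {:K}) (vbasis {:K}) (amull x)).

Definition integral_basis (b : (\dim {:K}).-tuple K) : Prop :=
  basis_of {:K} b /\
  ring_of_integers =
    [set x | exists c : 'I_(\dim {:K}) -> int, x = \sum_i tnth b i *~ c i].

Definition tuple_disc (b : (\dim {:K}).-tuple K) : rat :=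
  \det (\matrix_(i, j) field_trace (tnth b i * tnth b j)).

(* All integral bases have the same discriminant, so xget has nothing to      *)
(* choose; the default 0 is not the discriminant of any number field.         *)
Definition Disc : rat :=
  xget 0 [set tuple_disc b | b in [set b | integral_basis b]].

End NumberField.

Arguments ring_of_integers K : clear implicits.

(* An enumeration of the embeddings of K up to complex conjugation: all the   *)
(* real ones, and one from each pair of conjugate nonreal ones.               *)
Record arch_embeddings (R : realType) (K : fieldExtType rat) (r s : nat) :=
  ArchEmbeddings {
  real_emb : 'I_r -> {rmorphism K -> R};
  cplx_emb : 'I_s -> {rmorphism K -> R[i]};
  real_emb_inj : forall i j, real_emb i =1 real_emb j -> i = j;
  real_emb_surj : forall f : {rmorphism K -> R}, exists i, f =1 real_emb i;
  cplx_emb_nonreal : forall i, exists x, complex.Im (cplx_emb i x) != 0;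
  cplx_emb_inj : forall i j,
    cplx_emb i =1 cplx_emb j \/ cplx_emb i =1 conjc \o cplx_emb j -> i = j;
  cplx_emb_surj : forall f : {rmorphism K -> R[i]},
    (exists x, complex.Im (f x) != 0) ->
    exists i, f =1 cplx_emb i \/ f =1 conjc \o cplx_emb i
}.

(* R^r x C^s is 'rV[R]_(r + (s + s)): the real coordinates, then the real     *)
(* parts of the complex coordinates, then their imaginary parts.              *)
Definition arch_map (R : realType) (K : fieldExtType rat) (r s : nat)
    (E : arch_embeddings R K r s) (x : K) : 'rV[R]_(r + (s + s)) :=
  row_mx (\row_i real_emb E i x)
    (row_mx (\row_j complex.Re (cplx_emb E j x))
            (\row_j complex.Im (cplx_emb E j x))).

Definition arch_lattice (R : realType) (K : fieldExtType rat) (r s : nat)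
    (E : arch_embeddings R K r s) : set 'rV[R]_(r + (s + s)) :=
  arch_map E @` ring_of_integers K.

(* The library norm on 'rV[R]_m is the sup norm. *)
Definition euclidean_length (R : realType) (m : nat) (v : 'rV[R]_m) : R :=
  Num.sqrt (\sum_i v 0 i ^+ 2).

Definition has_indep_le (R : realType) (m : nat) (L : set 'rV[R]_m) (k : nat)
    (t : R) : Prop :=
  exists v : 'M[R]_(k, m), row_free v /\
    forall i, L (row i v) /\ euclidean_length (row i v) <= t.

(* Extended real, so that the value is +oo if L does not contain k linearly   *)
(* independent vectors.                                                       *)
Definition successive_minimum (R : realType) (m : nat) (L : set 'rV[R]_m)
    (k : nat) : \bar R :=
  ereal_inf [set t%:E | t in [set t : R | has_indep_le L k t]].

Lemma embeddings_finite (K : fieldExtType rat) (L : numFieldType) :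
  exists (z : K) (s : seq L), forall f : {rmorphism K -> L}, f z \in s /\
    (forall g : {rmorphism K -> L}, f z = g z -> f =1 g).
Proof.
have sepK : separable 1 {:K}%VS.
  apply/separableP => y _; apply: contraT => /separablePn_pchar[p pK]; exfalso.
  have := pK; rewrite (fmorph_pchar (in_alg K)) => pQ.
  by have := pchar_num rat p; rewrite pQ.
have ratE (f : {rmorphism K -> L}) (p : {poly rat}) :
    map_poly f (map_poly (in_alg K) p) = map_poly ratr p.
  by rewrite -map_poly_comp; apply: eq_map_poly => a; exact: fmorph_eq_rat.
have genK := eq_adjoin_separable_generator sepK (sub1v _).
set z := separable_generator _ _ in genK.
have /polyOver1P[q qE] := minPolyOver 1%VS z.
have q0 : map_poly ratr q != 0 :> {poly L}.
  rewrite map_poly_eq0; apply: contraTneq (monic_minPoly 1%VS z) => q0.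
  by rewrite qE q0 rmorph0 monicE lead_coef0 eq_sym oner_eq0.
have [s sP] : exists s : seq L, forall x, root (map_poly ratr q) x -> x \in s.
  move: (map_poly ratr q) q0 => t t0.
  elim: (size t) {-2}t (leqnn (size t)) t0 => {t} [t|k IH t szt t0].
    by rewrite leqn0 size_poly_eq0 => /eqP->; rewrite eqxx.
  have [[x rx]|nr] := pselect (exists x, root t x); last first.
    by exists [::] => x rx; case: nr; exists x.
  have /factor_theorem[u uE] := rx.
  have u0 : u != 0 by apply: contraNneq t0 => u0; rewrite uE u0 mul0r.
  have szu : (size u <= k)%N.
    by move: szt; rewrite uE size_Mmonic ?monicXsubC// size_XsubC addn2.
  have [s sP] := IH u szu u0.
  exists (x :: s) => y; rewrite uE rootM root_XsubC inE => /orP[/sP->|->//].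
  by rewrite orbT.
exists z, s => f; split=> [|g fg x].
  by apply: sP; rewrite -(ratE f) -qE fmorph_root root_minPoly.
have : x \in {:K}%VS by rewrite memvf.
by rewrite genK => /Fadjoin1_polyP[p ->]; rewrite -!horner_map !ratE fg.
Qed.

Lemma finite_representatives (T : Type) (L : eqType) (h : T -> L)
    (eqv : T -> T -> Prop) (P : T -> Prop) (s : seq L) :
    (forall f, h f \in s) -> (forall f g, h f = h g -> eqv f g) ->
    (forall f g, eqv f g -> eqv g f) ->
  exists (m : nat) (e : 'I_m -> T), [/\ forall i, P (e i),
    forall i j, eqv (e i) (e j) -> i = j &
    forall f, P f -> exists i, eqv f (e i)].
Proof.
move=> hs eqvh eqvC.
suff [e [uniqe eP einj esurj]] : exists e : seq {classic T}, [/\ uniq e,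
    forall x, x \in e -> P x,
    forall x y, x \in e -> y \in e -> eqv x y -> x = y &
    forall f, P f -> h f \in s -> exists2 x, x \in e & eqv f x].
  exists (size e), (tnth (in_tuple e)); split.
  - by move=> i; apply/eP/mem_tnth.
  - move=> i j /einj; rewrite !mem_tnth => /(_ isT isT) ij.
    by apply: (tuple_uniqP (in_tuple e) uniqe).
  - move=> f /esurj/(_ (hs f))[x xe fx].
    by have /tnthP[i xi] : x \in in_tuple e by []; exists i; rewrite -xi.
elim: s {hs} => [|a s [e [uniqe eP einj esurj]]]; first by exists [::]; split.
have [[f [Pf fa fe]]|nf] :=
  pselect (exists f, [/\ P f, h f = a & forall x, x \in e -> ~ eqv f x]); last first.
  exists e; split=> // f Pf; rewrite inE => /orP[/eqP fa|]; last exact: esurj.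
  apply: contrapT => fe; apply: nf; exists f; split=> // x xe fx.
  by apply: fe; exists x.
exists ((f : {classic T}) :: e); split.
- rewrite /= uniqe andbT; apply/negP => /fe; apply; exact: eqvh.
- by move=> x; rewrite inE => /predU1P[->//|/eP].
- move=> x y; rewrite !inE => /predU1P[->|xe] /predU1P[->|ye] //.
  + by move=> /fe -/(_ ye).
  + by move=> /eqvC /fe -/(_ xe).
  + exact: einj.
- move=> g Pg; rewrite inE => /orP[/eqP ga|/(esurj _ Pg)[x xe gx]].
    by exists (f : {classic T}); rewrite ?inE ?eqxx//; apply: eqvh; rewrite ga.
  by exists x; rewrite // inE xe orbT.
Qed.

Lemma arch_embeddings_exist (R : realType) (K : fieldExtType rat) :
  exists r s, inhabited (arch_embeddings R K r s).
Proof.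
have [z [sR sRP]] := embeddings_finite K R.
have [w [sC sCP]] := embeddings_finite K R[i].
have [r [e [_ einj esurj]]] := @finite_representatives {rmorphism K -> R} _
  (fun f => f z) (fun f g => f =1 g) (fun=> True) sR
  (fun f => (sRP f).1) (fun f => (sRP f).2) (fun f g fg x => esym (fg x)).
pose eqv (f g : {rmorphism K -> R[i]}) := f =1 g \/ f =1 conjc \o g.
have eqvC f g : eqv f g -> eqv g f.
  by case=> fg; [left|right] => x /=; rewrite fg//= conjcK.
have [s [t [tP tinj tsurj]]] := @finite_representatives {rmorphism K -> R[i]} _
  (fun f => f w) eqv (fun f => exists x, complex.Im (f x) != 0) sC
  (fun f => (sCP f).1) (fun f g fg => or_introl ((sCP f).2 g fg)) eqvC.
exists r, s; constructor.
by exists e t => // f; apply: esurj.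
Qed.

(* Main.v *)
(* The trace form T2 x = sum_k |psi_k x|^2 over all complex embeddings is a     *)
(* positive definite quadratic form on O_K whose Gram matrix in an integral   *)
(* basis has determinant |Disc K|.  Lattice reduction gives a basis a_0, ..., *)
(* a_(n-1) of O_K and positive d_k (squared Gram-Schmidt lengths) with        *)
(* product |Disc K|, with T2 a_k << d_k << d_l for k <= l, and such that any  *)
(* x in O_K with a nonzero last coordinate has T2 x >= d_(n-1).               *)
(* Since K is a field, the bilinear form "last coordinate of x * y" is        *)
(* nondegenerate, so some term of the Leibniz expansion of its determinant is *)
(* nonzero: there is a permutation p such that every a_k * a_(p k) has a      *)
(* nonzero last coordinate.  Hence                                            *)
(*   d_(n-1) <= T2 (a_k * a_(p k)) <= T2 a_k * T2 a_(p k) << d_k * d_(p k),   *)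
(* and multiplying over k gives d_(n-1)^n << |Disc K|^2.                      *)

Require Import Defs.
From HB Require Import structures.
From mathcomp Require Import all_boot all_order all_algebra all_field.
From mathcomp Require Import perm complex ring lra.
From mathcomp Require Import all_classical all_reals all_analysis.

Set Implicit Arguments.
Unset Strict Implicit.
Unset Printing Implicit Defensive.

Import Order.TTheory GRing.Theory Num.Theory.
Local Open Scope classical_set_scope.
Local Open Scope ring_scope.

(** * Reduction of positive definite quadratic forms *)

(** The form [T2] dominates the squared Euclidean length ([euclidean_le_T2]), so it suffices to find
    a basis of O_K on which [T2] is small. In an integral basis, which exists by
    [integral_basis_exists], the Gram matrix of [T2] is positive definite with determinant |Disc K|
    ([posdef_gram], [det_gram_conjugates]), and [reduced_basis] yields lengths d_k with product
    |Disc K|.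

    Reduction alone controls only that product; the largest d_k is controlled by multiplication in
    the field. By [det_product_coord] and [det_neq0_perm], some permutation p makes every a_k a_(p
    k) have a nonzero last coordinate. Then [T2M] gives d_(n-1) << d_k d_(p k), and the product over
    k gives d_(n-1) << |Disc K|^(2/n). The square root taken in passing from [T2] to length turns
    this into the exponent 1/n. [integral_reduced_basis] assembles the argument. *)

Definition qform (R : realType) (n : nat) (G : 'M[R]_n) (x : 'rV[R]_n) : R :=
  (x *m G *m x^T) 0 0.

Definition posdef (R : realType) (n : nat) (G : 'M[R]_n) : Prop :=
  G^T = G /\ forall x, x != 0 -> 0 < qform G x.

Definition intmx (R : realType) (m n : nat) (U : 'M[int]_(m, n)) : 'M[R]_(m, n) :=
  map_mx intr U.
Arguments intmx R {m n}.

(** For symmetric [G], the Schur complement of the corner entry: the Gram matrix of the remaining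
    basis vectors projected orthogonally to the first one. *)
Definition schur (R : realType) (n : nat) (G : 'M[R]_(1 + n)) : 'M[R]_n :=
  drsubmx G - (G 0 0)^-1 *: (dlsubmx G *m (dlsubmx G)^T).

Lemma qform_delta (R : realType) (n : nat) (G : 'M[R]_n) (i : 'I_n) :
  qform G (delta_mx 0 i) = G i i.
Proof. by rewrite /qform -rowE trmx_delta -colE !mxE. Qed.

Lemma posdef_diag_gt0 (R : realType) (n : nat) (G : 'M[R]_(1 + n)) :
  posdef G -> 0 < G 0 0.
Proof.
move=> [_ /(_ (delta_mx 0 0))].
rewrite qform_delta; apply; apply/eqP => /matrixP/(_ 0 0); rewrite !mxE => /eqP.
by rewrite oner_eq0.
Qed.

Lemma symmetric_block (R : realType) (n : nat) (G : 'M[R]_(1 + n)) :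
  G^T = G -> G = block_mx (G 0 0)%:M (dlsubmx G)^T (dlsubmx G) (drsubmx G).
Proof.
move=> GT; rewrite -[LHS]submxK; congr block_mx.
  by rewrite [LHS]mx11_scalar !mxE; congr (G _ _)%:M; apply/val_inj.
by apply/matrixP=> i j; rewrite !mxE -{1}GT mxE.
Qed.

Lemma block_ldl (R : realType) (n : nat) (G : 'M[R]_(1 + n)) :
  G^T = G -> G 0 0 != 0 ->
  let L := block_mx 1%:M 0 ((G 0 0)^-1 *: dlsubmx G) 1%:M in
  G = L *m block_mx (G 0 0)%:M 0 0 (schur G) *m L^T.
Proof.
move=> GT a0 L; rewrite {1}(symmetric_block GT) /L.
rewrite (tr_block_mx 1%:M) !mulmx_block !trmx1 trmx0 !mulmx1 !mul1mx.
rewrite !mulmx0 !mul0mx !addr0 !add0r linearZ /= mul_scalar_mx scalerA.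
rewrite mulfV// scale1r mul_mx_scalar scalerA mulfV// scale1r.
by congr block_mx; rewrite /schur -scalemxAr addrC subrK.
Qed.

Lemma det_schur (R : realType) (n : nat) (G : 'M[R]_(1 + n)) :
  posdef G -> \det G = G 0 0 * \det (schur G).
Proof.
move=> Gp; have a0 := posdef_diag_gt0 Gp.
rewrite {1}(block_ldl Gp.1 (lt0r_neq0 a0)) !det_mulmx det_tr.
by rewrite !det_lblock !det1 det_scalar1 !mul1r mulr1.
Qed.

Lemma qform_congr (R : realType) (n : nat) (G P : 'M[R]_n) (x : 'rV_n) :
  qform (P *m G *m P^T) x = qform G (x *m P).
Proof. by rewrite /qform trmx_mul !mulmxA. Qed.

(** Completing the square in [x0], read off from the factorization [block_ldl]. *)
Lemma qform_schur (R : realType) (n : nat) (G : 'M[R]_(1 + n)) (x0 : R)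
    (x : 'rV[R]_n) : posdef G ->
  qform G (row_mx x0%:M x) =
    G 0 0 * (x0 + (G 0 0)^-1 * (x *m dlsubmx G) 0 0) ^+ 2 + qform (schur G) x.
Proof.
move=> Gp; have a0 := posdef_diag_gt0 Gp.
rewrite {1}(block_ldl Gp.1 (lt0r_neq0 a0)) qform_congr /qform.
rewrite mul_row_block !mulmx1 mulmx0 add0r -scalemxAr.
set y := x0%:M + _.
rewrite mul_row_block !mulmx0 addr0 add0r tr_row_mx mul_row_col mxE; congr (_ + _).
rewrite mul_mx_scalar -scalemxAl mxE; congr (_ * _).
by rewrite mxE big_ord1 !mxE -expr2 eqxx mulr1n.
Qed.

Lemma qform_head (R : realType) (n : nat) (G : 'M[R]_(1 + n)) (x0 : R) :
  posdef G -> qform G (row_mx x0%:M 0) = G 0 0 * x0 ^+ 2.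
Proof.
move=> Gp; rewrite qform_schur// mul0mx mxE mulr0 addr0.
by rewrite /qform !mul0mx mxE addr0.
Qed.

Lemma posdef_schur (R : realType) (n : nat) (G : 'M[R]_(1 + n)) :
  posdef G -> posdef (schur G).
Proof.
move=> Gp; split.
  rewrite /schur !linearB /= linearZ /= trmx_mul trmxK; congr (_ - _).
  by rewrite trmx_drsub Gp.1.
move=> x x0; have a0 := posdef_diag_gt0 Gp.
have := Gp.2 (row_mx (- ((G 0 0)^-1 * (x *m dlsubmx G) 0 0))%:M x).
rewrite qform_schur// addNr expr0n mulr0 add0r; apply.
by rewrite row_mx_eq0 negb_and x0 orbT.
Qed.

Lemma posdef_congr (R : realType) (n : nat) (G P : 'M[R]_n) :
  posdef G -> P \in unitmx -> posdef (P *m G *m P^T).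
Proof.
move=> [GT Gp] uP; split.
  by rewrite !trmx_mul trmxK GT mulmxA.
move=> x x0; rewrite /qform !mulmxA -mulmxA -trmx_mul; apply: Gp.
by apply: contraNneq x0 => xP; rewrite -(mulmxK uP x) xP mul0mx.
Qed.

Lemma intmxM (R : realType) (m n p : nat) (A : 'M[int]_(m, n)) (B : 'M[int]_(n, p)) :
  intmx R (A *m B) = intmx R A *m intmx R B.
Proof. exact: map_mxM. Qed.

Lemma intmx_unit (R : realType) (n : nat) (U : 'M[int]_n) :
  U \in unitmx -> intmx R U \in unitmx.
Proof.
by rewrite !unitmxE det_map_mx => /(rmorph_unit (intr : {rmorphism int -> R})).
Qed.

Lemma det_intmx_sqr (R : realType) (n : nat) (U : 'M[int]_n) :
  U \in unitmx -> \det (intmx R U) ^+ 2 = 1.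
Proof.
rewrite unitmxE det_map_mx -rmorphXn /=.
by case/orP => /eqP->; rewrite ?sqrrN expr1n.
Qed.

Lemma row_mx_head (T : pzRingType) (n : nat) (x : 'rV[T]_(1 + n)) :
  x = row_mx (x 0 0)%:M (rsubmx x).
Proof.
rewrite -[LHS]hsubmxK; congr row_mx.
by rewrite [LHS]mx11_scalar !mxE; congr (x _ _)%:M; apply/val_inj.
Qed.

Lemma intmx_row (R : realType) (n : nat) (c0 : int) (c : 'rV[int]_n) :
  intmx R (row_mx c0%:M c) = row_mx (c0%:~R)%:M (intmx R c).
Proof. by rewrite /intmx map_row_mx map_scalar_mx. Qed.

(** By induction through [qform_schur]: a nonzero tail is bounded below by the Schur form, and a
    zero tail leaves [G 0 0] times a nonzero integer square. It makes the infimum in the reduction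
    positive. *)
Lemma posdef_int_lbound (R : realType) (n : nat) (G : 'M[R]_n) :
  posdef G -> exists2 e : R, 0 < e &
    forall c : 'rV[int]_n, c != 0 -> e <= qform G (intmx R c).
Proof.
elim: n => [|n IH] in G *.
  by move=> _; exists 1 => // c; rewrite [c]thinmx0 eqxx.
move: G; rewrite -[n.+1]/(1 + n)%N => G Gp; have a0 := posdef_diag_gt0 Gp.
have [e e0 eP] := IH _ (posdef_schur Gp).
exists (Num.min (G 0 0) e); first by rewrite lt_min a0.
move=> c; rewrite [c]row_mx_head; move: (c 0 0) (rsubmx c) => c0 {}c.
rewrite intmx_row ge_min => c_neq0.
have [cE|c_nz] := eqVneq c 0; last first.
  apply/orP; right; rewrite qform_schur// (le_trans (eP _ c_nz))// lerDr.
  by rewrite mulr_ge0 ?sqr_ge0 ?ltW.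
apply/orP; left; rewrite cE /intmx map_mx0 qform_head// ler_pMr//.
have c0_nz : c0 != 0.
  by apply: contraNneq c_neq0 => ->; rewrite cE raddf0 row_mx0 eqxx.
rewrite -rmorphXn ler1z -gtz0_ge1 lt_neqAle sqr_ge0 andbT eq_sym.
by rewrite expf_eq0.
Qed.

(* An infimum within a factor 4/3 is enough for the reduction, so the minimum   *)
(* need not be shown to be attained.                                          *)
Lemma unimodular_near_min (R : realType) (n : nat) (G : 'M[R]_(1 + n)) :
  posdef G -> exists2 P : 'M[int]_(1 + n), P \in unitmx &
    forall (U : 'M[int]_(1 + n)) k, U \in unitmx ->
      3 * qform G (intmx R (row 0 P)) <= 4 * qform G (intmx R (row k U)).
Proof.
move=> Gp; have [e e0 eP] := posdef_int_lbound Gp.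
pose q (U : 'M[int]_(1 + n)) k := qform G (intmx R (row k U)).
(* Ranging over rows of unimodular matrices, instead of all nonzero integer vectors, makes a
   near-minimal vector part of a basis from the start. *)
pose S : set R := [set t | exists U k, U \in unitmx /\ t = q U k].
have Se t : S t -> e <= t.
  move=> [U [k [uU ->]]]; apply: eP; apply/eqP => U0.
  have : row k U *m invmx U = 0 by rewrite U0 mul0mx.
  rewrite -row_mul mulmxV// => /matrixP/(_ 0 k); rewrite !mxE eqxx.
  by move/eqP; rewrite oner_eq0.
have S1 : S (q 1%:M 0) by exists 1%:M, 0; rewrite unitmx1.
have infS : has_inf S by split; [exists (q 1%:M 0) | exists e].
have mu0 : 0 < inf S.
  by apply: (lt_le_trans e0); apply: lb_le_inf => //; exact: infS.1.
(* The slack [inf S / 3] puts the chosen value below 4/3 of the infimum. *)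
have [_ [V [k [uV ->]]] Vmu] := @inf_adherent _ S (inf S / 3) (divr_gt0 mu0 (ltr0n _ 3)) infS.
exists (tperm_mx 0 k *m V).
  by rewrite unitmx_mul uV andbT unitmx_perm.
have -> : row 0 (tperm_mx 0 k *m V) = row k V.
  by rewrite -xrowE; apply/rowP => j; rewrite !mxE tpermL.
move=> U l uU; have : inf S <= q U l.
  by apply: ge_inf; [exact: infS.2 | exists U, l].
by rewrite -/(q V k) -/(q U l); move: Vmu; lra.
Qed.

(* The d i are the squared Gram-Schmidt lengths of the rows of U.              *)
Lemma reduced_basis (R : realType) (n : nat) (G : 'M[R]_n) :
  posdef G -> exists (U : 'M[int]_n) (d : 'I_n -> R),
  [/\ U \in unitmx, forall i, 0 < d i,
      forall i j : 'I_n, (i <= j)%N -> d i <= 2 ^+ j * d j,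
      \prod_i d i = \det G &
      (forall k, qform G (intmx R (row k U)) <= \sum_(j < n | (j <= k)%N) d j) /\
      forall (k : 'I_n) (x : 'rV[R]_n), (forall j : 'I_n, (k < j)%N -> x 0 j = 0) ->
        d k * x 0 k ^+ 2 <= qform G (x *m intmx R U)].
Proof.
elim: n => [|n IH] in G *.
  move=> _; exists 1%:M, (fun=> 1); split => //; rewrite ?unitmx1//.
  - by move=> [].
  - by rewrite det_mx00 big_ord0.
  - by split=> [[]|[]].
move: G; rewrite -[n.+1]/(1 + n)%N => G Gp.
have [P uP Pmin] := unimodular_near_min Gp.
have uP' := intmx_unit R uP.
pose H := intmx R P *m G *m (intmx R P)^T.
have Hp : posdef H by exact: posdef_congr.
have Hmin (U : 'M[int]_(1 + n)) k : U \in unitmx ->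
    3 * H 0 0 <= 4 * qform H (intmx R (row k U)).
  move=> uU; rewrite qform_congr -intmxM -row_mul.
  have -> : H 0 0 = qform G (intmx R (row 0 P)).
    by rewrite -qform_delta qform_congr -rowE -map_row.
  by apply: Pmin; rewrite unitmx_mul uU.
have a0 := posdef_diag_gt0 Hp.
have [V [d' [uV d'0 d'le d'prod [rowV colV]]]] := IH _ (posdef_schur Hp).
pose a := H 0 0.
pose y k := (intmx R (row k V) *m dlsubmx H) 0 0 / a.
(* Size reduction: [t k 0] is minus the integer nearest to [y k], so |t_k + y_k| is at most 1/2 and
   lifting a row from the projected lattice adds at most a/4 to the form. *)
pose t : 'cV[int]_n := \col_k (- Num.floor (y k + 2^-1)).
have tP k : ((t k 0)%:~R + y k) ^+ 2 <= 4^-1.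
  rewrite !mxE rmorphN /=; set f := Num.floor _.
  have := floor_itv (y k + 2^-1); rewrite -/f => /andP[].
  by rewrite rmorphD /= => f1 f2; nra.
pose W : 'M[int]_(1 + n) := block_mx 1%:M 0 t V.
have uW : W \in unitmx by move: uV; rewrite !unitmxE det_lblock det1 mul1r.
have row0W : row 0 W = row_mx 1%:M 0.
  have -> : row 0 W = row (lshift n 0) W by congr row; apply/val_inj.
  by rewrite rowKu row_id.
have rowSW k : row (lift 0 k) W = row_mx (t k 0)%:M (row k V).
  have -> : row (lift 0 k) W = row (rshift 1 k) W by rewrite rshift1.
  rewrite rowKd row_row_mx; congr row_mx.
  by rewrite [LHS]mx11_scalar mxE.
pose d (i : 'I_(1 + n)) := oapp d' a (unlift 0 i).
have d_0 : d 0 = a by rewrite /d unlift_none.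
have d_S k : d (lift 0 k) = d' k by rewrite /d liftK.
have qSW k : qform H (intmx R (row (lift 0 k) W)) <=
    4^-1 * a + \sum_(j < n | (j <= k)%N) d' j.
  rewrite rowSW intmx_row qform_schur//; apply: lerD; last exact: rowV.
  by rewrite mulrC -/a ler_pM2r// mulrC.
have sum_head (F : 'I_(1 + n) -> R) :
    \sum_i F i = F 0 + \sum_(i < n) F (lift 0 i) by exact: big_ord_recl.
have prod_head (F : 'I_(1 + n) -> R) :
    \prod_i F i = F 0 * \prod_(i < n) F (lift 0 i) by exact: big_ord_recl.
exists (W *m P), d; split.
- by rewrite unitmx_mul uW.
- by move=> i; case: (unliftP 0 i) => [j|] ->; rewrite ?d_0 ?d_S.
- move=> i j; case: (unliftP 0 i) => [i'|] ->; case: (unliftP 0 j) => [j'|] ->.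
  + rewrite !d_S ltnS => /d'le/le_trans; apply; rewrite ler_pM2r//.
    by rewrite ler_eXn2l ?ltr1n.
  + by [].
  + rewrite d_0 d_S => _.
    (* Near-minimality of the first vector against the first lifted row gives 3a <= 4(a/4 + d'_0),
       so a <= 2 d'_0; the inductive bound on d' supplies the remaining powers of 2. *)
    pose k0 := Ordinal (leq_ltn_trans (leq0n j') (ltn_ord j')).
    have := Hmin W (lift 0 k0) uW; rewrite -/a.
    have := qSW k0; rewrite (big_pred1 k0); last first.
      by move=> l /=; rewrite leqn0.
    have := d'le k0 j' (leq0n _); rewrite lift0 exprS -mulrA.
    move: (2 ^+ j' * d' j') (qform H _) => u v; lra.
  + by rewrite d_0 mul1r.
- rewrite prod_head d_0 (eq_bigr d')// d'prod -det_schur//.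
  by rewrite !det_mulmx det_tr mulrAC -expr2 det_intmx_sqr// mul1r.
split.
- move=> k; rewrite row_mul intmxM -qform_congr -/H.
  case: (unliftP 0 k) => [k'|] ->.
    rewrite (le_trans (qSW k'))// [leRHS]big_mkcond sum_head d_0 /=.
    rewrite lerD ?ler_piMl ?(ltW a0) ?invf_le1//; first by lra.
    rewrite [leRHS]big_mkcond /= [leLHS]big_mkcond /=.
    by apply: ler_sum => j _; rewrite d_S.
  rewrite row0W intmx_row /intmx map_mx0 qform_head// expr1n mulr1 -/a (bigD1 0)//= d_0 lerDl.
  apply: sumr_ge0 => j _; case: (unliftP 0 j) => [j'|] ->.
    by rewrite d_S ltW.
  by rewrite d_0 ltW.
- move=> k x xk; rewrite intmxM mulmxA -qform_congr -/H.
  have -> : x *m intmx R W = row_mx (x 0 0 + (rsubmx x *m intmx R t) 0 0)%:M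
      (rsubmx x *m intmx R V).
    rewrite [in LHS](row_mx_head x) /intmx map_block_mx mul_row_block.
    rewrite map_mx1 mulmx1 map_mx0 mulmx0 add0r; congr row_mx.
    by rewrite [LHS]mx11_scalar mxE [in X in X + _]mxE eqxx mulr1n.
  case: (unliftP 0 k) xk => [k'|] -> xk.
    (* The completed square is nonnegative and is dropped, leaving the induction hypothesis for the
       Schur form. *)
    rewrite d_S qform_schur//; apply: (@le_trans _ _ (qform (schur H) (rsubmx x *m intmx R V))).
      have := colV k' (rsubmx x); rewrite mxE rshift1; apply=> j kj.
      by rewrite mxE rshift1; apply: xk; rewrite !lift0 ltnS.
    by rewrite lerDr mulr_ge0 ?sqr_ge0 ?ltW.
  have -> : rsubmx x = 0.
    by apply/rowP => j; rewrite !mxE rshift1 xk// lift0.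
  by rewrite !mul0mx qform_head// d_0 [X in _ + X]mxE addr0.
Qed.

(** * Embeddings, traces and discriminants *)

Lemma number_field_generator (K : fieldExtType rat) :
  exists z : K, [/\ {:K}%VS = <<1; z>>%VS :> {vspace K} & separable_element 1 z].
Proof.
have sepK : separable 1 {:K}%VS.
  apply/separableP => y _; apply: contraT => /separablePn_pchar[p pK]; exfalso.
  have := pK; rewrite (fmorph_pchar (in_alg K)) => pQ.
  by have := pchar_num rat p; rewrite pQ.
exists (separable_generator 1 {:K}); split; last exact: separable_generatorP.
exact: eq_adjoin_separable_generator sepK (sub1v _).
Qed.

Lemma map_ratr_in_alg (K : fieldExtType rat) (L : numFieldType)
    (f : {rmorphism K -> L}) (p : {poly rat}) :
  map_poly f (map_poly (in_alg K) p) = map_poly ratr p.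
Proof. by rewrite -map_poly_comp; apply: eq_map_poly => a; exact: fmorph_eq_rat. Qed.

Lemma embedding_eq (K : fieldExtType rat) (L : numFieldType) (z : K)
    (f g : {rmorphism K -> L}) :
  {:K}%VS = <<1; z>>%VS :> {vspace K} -> f z = g z -> f =1 g.
Proof.
move=> genK fg x; have : x \in {:K}%VS by rewrite memvf.
rewrite genK => /Fadjoin1_polyP[p ->].
by rewrite -!horner_map !map_ratr_in_alg /= fg.
Qed.

(** The embedding sends p(z) to p(rho). It is well defined because polynomials agreeing at [z]
    differ by a multiple of the minimal polynomial, which vanishes at rho. *)
Lemma embedding_of_root (K : fieldExtType rat) (L : numFieldType) (z : K)
    (q : {poly rat}) (rho : L) :
  {:K}%VS = <<1; z>>%VS :> {vspace K} -> minPoly 1 z = map_poly (in_alg K) q ->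
  root (map_poly ratr q) rho -> exists f : {rmorphism K -> L}, f z = rho.
Proof.
move=> genK minE rho_root.
have exP x : exists p, (map_poly (in_alg K) p).[z] = x.
  have : x \in {:K}%VS by rewrite memvf.
  by rewrite genK => /Fadjoin1_polyP[p ->]; exists p.
pose g x := sval (cid (exP x)).
have gP x : (map_poly (in_alg K) (g x)).[z] = x by rewrite /g; case: cid.
have eval_eq p1 p2 : (map_poly (in_alg K) p1).[z] = (map_poly (in_alg K) p2).[z] ->
    (map_poly ratr p1).[rho] = (map_poly ratr p2).[rho] :> L.
  move=> /eqP; rewrite -subr_eq0 -hornerN -hornerD -rmorphB => p12.
  apply/eqP; rewrite -subr_eq0 -hornerN -hornerD -rmorphB.
  have : minPoly 1 z %| map_poly (in_alg K) (p1 - p2).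
    by apply: minPoly_dvdp => //; apply/polyOver1P; exists (p1 - p2).
  rewrite minE dvdp_map => /dvdpP[r ->].
  by rewrite rmorphM hornerM (eqP rho_root) mulr0.
pose f x := (map_poly ratr (g x)).[rho] : L.
have f_poly p : f (map_poly (in_alg K) p).[z] = (map_poly ratr p).[rho].
  exact: eval_eq (gP _).
have fB : zmod_morphism f.
  move=> x y; rewrite -[in LHS](gP x) -[in LHS](gP y) -hornerN -hornerD -rmorphB.
  by rewrite f_poly rmorphB hornerD hornerN.
have fM : monoid_morphism f.
  split.
    by have := f_poly 1; rewrite !rmorph1 !hornerC.
  move=> x y; rewrite -[in LHS](gP x) -[in LHS](gP y) -hornerM -rmorphM.
  by rewrite f_poly rmorphM hornerM.
pose F : {rmorphism K -> L} :=
  HB.pack f (GRing.isZmodMorphism.Build K L f fB) (GRing.isMonoidMorphism.Build K L f fM).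
by exists F; have := f_poly 'X; rewrite !map_polyX !hornerX.
Qed.

(** All complex embeddings, indexed like the coordinates of [arch_map]: the conjugate of each chosen
    nonreal embedding occupies the slot of its imaginary part. *)
Definition embedding (R : realType) (K : fieldExtType rat) (r s : nat)
    (E : arch_embeddings R K r s) (k : 'I_(r + (s + s))) : {rmorphism K -> R[i]} :=
  match fintype.split k with
  | inl i => real_complex R \o real_emb E i
  | inr l => match fintype.split l with
             | inl j => cplx_emb E j
             | inr j => conjc \o cplx_emb E j
             end
  end.

Lemma embeddingP (R : realType) (K : fieldExtType rat) (r s : nat)
    (E : arch_embeddings R K r s) : 
  [/\ forall i x, embedding E (lshift (s + s) i) x = (real_emb E i x)%:C%C,
     forall j x, embedding E (rshift r (lshift s j)) x = cplx_emb E j x &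
     forall j x, embedding E (rshift r (rshift s j)) x = conjc (cplx_emb E j x)].
Proof.
split=> i x; rewrite /embedding.
- by rewrite (unsplitK (inl i)).
- by rewrite (unsplitK (inr (lshift s i))) (unsplitK (inl i)).
- by rewrite (unsplitK (inr (rshift s i))) (unsplitK (inr i)).
Qed.
Lemma embedding_inj (R : realType) (K : fieldExtType rat) (r s : nat)
    (E : arch_embeddings R K r s) (k l : 'I_(r + (s + s))) :
  embedding E k =1 embedding E l -> k = l.
Proof.
have [eR eC eCc] := embeddingP E.
have nonreal j : ~ forall x, complex.Im (cplx_emb E j x) = 0.
  by move=> j0; have [x /eqP] := cplx_emb_nonreal E j; apply.
(* One representative per conjugate pair forces j1 = j2, and an embedding equal to its own conjugate
   would be real. *)
have not_conj j1 j2 : ~ forall x, cplx_emb E j1 x = conjc (cplx_emb E j2 x).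
  move=> j12; have j1E : j1 = j2 by apply: (@cplx_emb_inj _ _ _ _ E); right=> x; exact: j12.
  apply: (nonreal j2) => x; have := j12 x; rewrite j1E.
  by case: (cplx_emb E j2 x) => a b [] /= bE; lra.
case: (split_ordP k) => [i1 ->|k' ->]; last case: (split_ordP k') => [j1 ->|j1 ->];
  (case: (split_ordP l) => [i2 ->|l' ->]; last case: (split_ordP l') => [j2 ->|j2 ->]) => kl.
- congr lshift; apply: (@real_emb_inj _ _ _ _ E) => x.
  by have := kl x; rewrite !eR => -[].
- by case: (nonreal j2) => x; have := kl x; rewrite eR eC => <-.
- case: (nonreal j2) => x; have := kl x; rewrite eR eCc.
  by case: (cplx_emb E j2 x) => a b [] _ /= b0; lra.
- by case: (nonreal j1) => x; have := kl x; rewrite eR eC => ->.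
- congr (rshift _ (lshift _ _)); apply: (@cplx_emb_inj _ _ _ _ E); left=> x.
  by have := kl x; rewrite !eC.
- by case: (not_conj j1 j2) => x; have := kl x; rewrite eC eCc.
- case: (nonreal j1) => x; have := kl x; rewrite eR eCc.
  by case: (cplx_emb E j1 x) => a b [] _ /= b0; lra.
- by case: (not_conj j2 j1) => x; have := kl x; rewrite eC eCc.
- congr (rshift _ (rshift _ _)); apply: (@cplx_emb_inj _ _ _ _ E); left=> x.
  by have := kl x; rewrite !eCc => /(can_inj (@conjcK _)).
Qed.

Lemma embedding_surj (R : realType) (K : fieldExtType rat) (r s : nat)
    (E : arch_embeddings R K r s) (f : {rmorphism K -> R[i]}) :
  exists k, f =1 embedding E k.
Proof.
have [eR eC eCc] := embeddingP E.
have [/cplx_emb_surj-/(_ _ _ E)[j []fj]|f_real] := pselect (exists x, complex.Im (f x) != 0).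
- by exists (rshift r (lshift s j)) => x; rewrite eC fj.
- by exists (rshift r (rshift s j)) => x; rewrite eCc fj.
have fE x : f x = (complex.Re (f x))%:C%C.
  have : complex.Im (f x) = 0.
    by apply/eqP; apply: contrapT => /negP fx; apply: f_real; exists x.
  by case: (f x) => a b /= ->.
pose g x : R := complex.Re (f x).
have gB : zmod_morphism g by move=> x y; rewrite /g rmorphB; case: (f x) (f y) => [? ?] [].
have gM : monoid_morphism g.
  split; first by rewrite /g rmorph1.
  by move=> x y; rewrite /g rmorphM (fE x) (fE y) /= mulr0 subr0.
pose F : {rmorphism K -> R} :=
  HB.pack g (GRing.isZmodMorphism.Build K R g gB) (GRing.isMonoidMorphism.Build K R g gM).
have [i Fi] := real_emb_surj E F.
by exists (lshift (s + s) i) => x; rewrite eR -Fi fE.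
Qed.

(** Evaluation at a generator identifies the embeddings with the roots in [R[i]] of its minimal
    polynomial, which is separable and has degree [\dim {:K}]. *)
Lemma dim_embeddings (R : realType) (K : fieldExtType rat) (r s : nat)
    (E : arch_embeddings R K r s) : \dim {:K} = (r + (s + s))%N.
Proof.
have [z [genK sepz]] := number_field_generator K.
have /polyOver1P[q minE] := minPolyOver 1%VS z.
have sizeq : size q = (\dim {:K}).+1.
  by rewrite genK dim_Fadjoin dimv1 muln1 -size_minPoly minE size_map_poly.
have [rs rsE] := closed_field_poly_normal (map_poly ratr q : {poly R[i]}).
have lead1 : lead_coef (map_poly ratr q : {poly R[i]}) = 1.
  apply/monicP; rewrite map_monic -(map_monic (in_alg K)) -minE; exact: monic_minPoly.
rewrite lead1 scale1r in rsE.
have uniq_rs : uniq rs.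
  rewrite -separable_prod_XsubC -rsE separable_map.
  by move: sepz; rewrite /separable_element minE separable_map.
have mem_rs : rs =i [seq embedding E k z | k <- enum 'I_(r + (s + s))].
  move=> rho; rewrite -root_prod_XsubC -rsE; apply/idP/mapP => [rho_root|[k _ ->]].
    have [f fz] := embedding_of_root genK minE rho_root.
    have [k fk] := embedding_surj E f.
    by exists k; rewrite ?mem_enum // -fk fz.
  by rewrite -(map_ratr_in_alg (embedding E k)) -minE fmorph_root root_minPoly.
have uniq_emb : uniq [seq embedding E k z | k <- enum 'I_(r + (s + s))].
  rewrite map_inj_uniq ?enum_uniq // => k l kl; apply: embedding_inj.
  exact: embedding_eq genK kl.
have := perm_size (uniq_perm uniq_rs uniq_emb mem_rs).
rewrite size_map size_enum_ord => <-; apply: succn_inj.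
by rewrite -sizeq -(size_map_poly (ratr : {rmorphism rat -> R[i]})) rsE size_prod_XsubC.
Qed.

(** * The conjugate matrix, and trace and discriminant in terms of it *)

Definition conjugates (K : fieldExtType rat) (L : numFieldType) (n : nat)
    (psi : 'I_n -> {rmorphism K -> L}) (x : K) : 'rV[L]_n :=
  \row_k psi k x.

Definition conjugate_matrix (K : fieldExtType rat) (L : numFieldType) (n m : nat)
    (psi : 'I_n -> {rmorphism K -> L}) (b : m.-tuple K) : 'M[L]_(m, n) :=
  \matrix_(i, k) psi k (tnth b i).

Lemma basis_expansion (K : fieldExtType rat) (b : (\dim {:K}).-tuple K) (x : K) :
  basis_of {:K} b -> x = \sum_i coord b i x *: tnth b i.
Proof.
move=> bB; rewrite [LHS](coord_basis bB) ?memvf//.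
by apply: eq_bigr => i _; rewrite (tnth_nth 0).
Qed.

Lemma conjugates_expansion (K : fieldExtType rat) (L : numFieldType) (n : nat)
    (psi : 'I_n -> {rmorphism K -> L}) (b : (\dim {:K}).-tuple K) (x : K) :
  basis_of {:K} b ->
  conjugates psi x = map_mx ratr (passmx.rVof b x) *m conjugate_matrix psi b.
Proof.
move=> bB; apply/rowP => k; rewrite !mxE {1}(basis_expansion x bB) rmorph_sum.
apply: eq_bigr => i _; rewrite !mxE -mulr_algl rmorphM; congr (_ * _).
exact: (fmorph_eq_rat (psi k \o in_alg K)).
Qed.

(** A vector killed by the matrix pairs to zero with the conjugates of every element, in particular
    of the powers of [z]; these form a Vandermonde matrix, invertible since the [psi k z] are
    distinct. *)
Lemma conjugate_matrix_unit (K : fieldExtType rat) (L : numFieldType)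
    (psi : 'I_(\dim {:K}) -> {rmorphism K -> L}) (b : (\dim {:K}).-tuple K) (z : K) :
  basis_of {:K} b -> injective (fun k => psi k z) ->
  conjugate_matrix psi b \in unitmx.
Proof.
move=> bB zI; rewrite -unitmx_tr unitmxE unitfE; apply/det0P => -[v v0 vV].
have vpsi x : conjugates psi x *m v^T = 0.
  rewrite (conjugates_expansion psi x bB) -mulmxA -[X in _ *m X]trmxK trmx_mul.
  by rewrite trmxK vV trmx0 mulmx0.
have : Vandermonde (\dim {:K}) (conjugates psi z) *m v^T = 0.
  apply/row_matrixP => i; rewrite row_mul row0 -(vpsi (z ^+ i)); congr (_ *m _).
  by apply/rowP => k; rewrite !mxE rmorphXn.
move/(congr1 (mulmx (invmx (Vandermonde (\dim {:K}) (conjugates psi z))))).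
rewrite mulKmx; last first.
  rewrite unitmxE det_Vandermonde unitfE; apply/prodf_neq0 => i _.
  apply/prodf_neq0 => j ij; rewrite !mxE subr_eq0.
  by apply: contraTneq ij => /zI->; rewrite ltnn.
rewrite mulmx0 => /(congr1 trmx); rewrite trmxK trmx0 => v00.
by rewrite v00 eqxx in v0.
Qed.

(** The conjugate matrix of a basis diagonalizes multiplication by [x], with eigenvalues the
    conjugates of [x]. *)
Lemma field_trace_conjugates (K : fieldExtType rat) (L : numFieldType)
    (psi : 'I_(\dim {:K}) -> {rmorphism K -> L}) (z x : K) :
  injective (fun k => psi k z) -> ratr (field_trace x) = \sum_k psi k x.
Proof.
move=> zI; set b := vbasis {:K}; have bB : basis_of {:K} b := vbasisP _.
have Vu := conjugate_matrix_unit bB zI.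
rewrite /field_trace -/b; set M := passmx.mxof _ _ _.
have MV : map_mx ratr M *m conjugate_matrix psi b =
    conjugate_matrix psi b *m diag_mx (conjugates psi x).
  apply/row_matrixP => i; rewrite row_mul -map_row (rowE i M) passmx.mul_mxof.
  rewrite -conjugates_expansion// passmx.vecof_delta lfunE /= mul_mx_diag.
  by apply/rowP => k; rewrite !mxE rmorphM mulrC (tnth_nth 0).
have <- : \tr (map_mx ratr M) = ratr (\tr M) :> L.
  by rewrite /mxtrace rmorph_sum; apply: eq_bigr => i _; rewrite mxE.
rewrite -[map_mx ratr M](mulmxK Vu) MV mxtrace_mulC mulKmx// mxtrace_diag.
by apply: eq_bigr => k _; rewrite mxE.
Qed.

Lemma tuple_disc_conjugates (K : fieldExtType rat) (L : numFieldType)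
    (psi : 'I_(\dim {:K}) -> {rmorphism K -> L}) (z : K) (b : (\dim {:K}).-tuple K) :
  injective (fun k => psi k z) ->
  ratr (tuple_disc b) = \det (conjugate_matrix psi b) ^+ 2 :> L.
Proof.
move=> zI; rewrite /tuple_disc -det_map_mx.
transitivity (\det (conjugate_matrix psi b *m (conjugate_matrix psi b)^T)); last first.
  by rewrite det_mulmx det_tr expr2.
congr (\det _); apply/matrixP => i j; rewrite !mxE /= (field_trace_conjugates _ zI).
by apply: eq_bigr => k _; rewrite !mxE rmorphM.
Qed.

Lemma integral_rat_int (q : rat) :
  integralOver (intr : int -> rat) q -> exists m : int, q = m%:~R.
Proof.
move=> [p p_monic p_root].
have : (ratr q : algC) \in Aint.
  apply: (@root_monic_Aint (map_poly ratr (map_poly intr p))).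
  - by rewrite fmorph_root.
  - by rewrite map_monic monic_map.
  - apply/polyOverP => i; rewrite !coef_map /= ratr_int; exact: intr_int.
move/(Cint_rat_Aint (Crat_rat q)) => /intrP[m qm]; exists m.
by apply: (fmorph_inj (ratr : {rmorphism rat -> algC})); rewrite /= qm ratr_int.
Qed.

(** The trace is a sum of conjugates, each integral over the integers, and it is rational. *)
Lemma integral_trace_int (K : fieldExtType rat) (L : numFieldType)
    (psi : 'I_(\dim {:K}) -> {rmorphism K -> L}) (z x : K) :
  injective (fun k => psi k z) -> ring_of_integers K x ->
  exists m : int, field_trace x = m%:~R.
Proof.
move=> zI xO; apply: integral_rat_int.
have : integralOver (intr : int -> L) (ratr (field_trace x)).
  rewrite (field_trace_conjugates _ zI).
  apply: (big_ind (integralOver (intr : int -> L))).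
  - exact: mxpoly.integral0.
  - exact: integral_add.
  - move=> k _; have [p p_monic p_root] := xO; exists p => //.
    have -> : map_poly intr p = map_poly (psi k) (map_poly intr p).
      by rewrite -map_poly_comp; apply: eq_map_poly => a /=; rewrite rmorph_int.
    by rewrite fmorph_root.
move=> [p p_monic p_root]; exists p => //; move: p_root.
have -> : map_poly intr p = map_poly ratr (map_poly intr p) :> {poly L}.
  by rewrite -map_poly_comp; apply: eq_map_poly => a /=; rewrite ratr_int.
by rewrite fmorph_root.
Qed.

(** * Existence of an integral basis *)

Lemma integral_eigenvalue (K : fieldType) (n : nat) (N : 'M[int]_n)
    (v : 'rV[K]_n) (y : K) :
  v != 0 -> v *m map_mx intr N = y *: v -> integralOver (intr : int -> K) y.
Proof.
move=> v0 vN; exists (char_poly N); first exact: char_poly_monic.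
by rewrite map_char_poly -eigenvalue_root_char; apply/eigenvalueP; exists v.
Qed.

Lemma rat_matrix_denominator (m n : nat) (M : 'M[rat]_(m, n)) :
  exists2 a : int, a != 0 & exists N : 'M[int]_(m, n), a%:~R *: M = map_mx intr N.
Proof.
exists (\prod_i \prod_j denq (M i j)).
  by apply/prodf_neq0 => i _; apply/prodf_neq0 => j _; exact: denq_neq0.
exists (\matrix_(i, j) (\prod_(k | k != i) \prod_l denq (M k l) *
  \prod_(l | l != j) denq (M i l) * numq (M i j))).
apply/matrixP => i j; rewrite !mxE (bigD1 i)//= (bigD1 j)//= !rmorphM /=.
rewrite -[X in _ * X = _]divq_num_den.
have : (denq (M i j))%:~R != 0 :> rat by rewrite intr_eq0 denq_neq0.
move: (denq (M i j))%:~R => d d0.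
rewrite -[RHS]mulrA mulrC.
set A := _%:~R; set B := _%:~R; set C := _%:~R; field.
by [].
Qed.

(** Clear the denominators of the matrix of multiplication by [x]; the vector of basis elements is
    then an eigenvector of an integer matrix, with eigenvalue [x *~ a]. *)
Lemma integral_multiple (K : fieldExtType rat) (x : K) :
  exists2 a : int, a != 0 & ring_of_integers K (x *~ a).
Proof.
set b := vbasis {:K}; have bB : basis_of {:K} b := vbasisP _.
pose M := passmx.mxof b b (amull x).
have [a a0 [N aN]] := rat_matrix_denominator M; exists a => //.
apply: (@integral_eigenvalue K _ N^T (\row_i tnth b i)).
  apply/eqP => /rowP b0; have := basis_expansion 1 bB.
  rewrite big1 ?oner_eq0 => [/eqP|i _]; first by rewrite oner_eq0.
  by have := b0 i; rewrite !mxE => ->; rewrite scaler0.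
apply/rowP => i; rewrite !mxE.
have : x * tnth b i = \sum_j M i j *: tnth b j.
  rewrite [LHS](basis_expansion _ bB); apply: eq_bigr => j _; congr (_ *: _).
  by rewrite !mxE passmx.vecof_delta lfunE /= (tnth_nth 0).
move=> xb; rewrite mulrzAl xb -mulrzr mulr_suml; apply: eq_bigr => j _.
rewrite !mxE; have /matrixP/(_ i j) := aN; rewrite !mxE => aNij.
rewrite -(rmorph_int (in_alg K) (N i j)) -aNij mulr_algr mulrzr -scaler_int.
by rewrite scalerA.
Qed.

Lemma conjugate_matrix_change (K : fieldExtType rat) (L : numFieldType) (m n : nat)
    (psi : 'I_n -> {rmorphism K -> L}) (b b' : m.-tuple K) (P : 'M[rat]_m) :
  (forall i, tnth b' i = \sum_j P i j *: tnth b j) ->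
  conjugate_matrix psi b' = map_mx ratr P *m conjugate_matrix psi b.
Proof.
move=> b'E; apply/matrixP => i k; rewrite !mxE b'E rmorph_sum.
apply: eq_bigr => j _; rewrite !mxE -mulr_algl rmorphM; congr (_ * _).
exact: (fmorph_eq_rat (psi k \o in_alg K)).
Qed.

Lemma tuple_disc_change (K : fieldExtType rat) (L : numFieldType)
    (psi : 'I_(\dim {:K}) -> {rmorphism K -> L}) (z : K)
    (b b' : (\dim {:K}).-tuple K) (P : 'M[rat]_(\dim {:K})) :
  injective (fun k => psi k z) ->
  (forall i, tnth b' i = \sum_j P i j *: tnth b j) ->
  tuple_disc b' = \det P ^+ 2 * tuple_disc b.
Proof.
move=> zI b'E; apply: (fmorph_inj (ratr : {rmorphism rat -> L})).
rewrite /= rmorphM rmorphXn /= !(tuple_disc_conjugates _ zI).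
by rewrite (conjugate_matrix_change _ b'E) det_mulmx det_map_mx exprMn.
Qed.

(** Both sides amount to invertibility of the conjugate matrix, whose determinant squares to the
    discriminant. *)
Lemma tuple_disc_basis (K : fieldExtType rat) (L : numFieldType)
    (psi : 'I_(\dim {:K}) -> {rmorphism K -> L}) (z : K) (b : (\dim {:K}).-tuple K) :
  injective (fun k => psi k z) -> basis_of {:K} b = (tuple_disc b != 0).
Proof.
move=> zI; rewrite -(fmorph_eq0 (ratr : {rmorphism rat -> L})) /=.
rewrite (tuple_disc_conjugates _ zI) expf_eq0 /=.
apply/idP/idP => [bB|V0].
  by have := conjugate_matrix_unit bB zI; rewrite unitmxE unitfE.
have Vu : conjugate_matrix psi b \in unitmx by rewrite unitmxE unitfE.
rewrite basisEfree size_tuple leqnn andbT subvf andbT; apply/freeP => c c0 i.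
have : map_mx ratr (\row_j c j) *m conjugate_matrix psi b = 0.
  apply/rowP => k; rewrite [RHS]mxE; transitivity (psi k (\sum_i c i *: b`_i)).
    2: by rewrite c0 rmorph0.
  rewrite mxE rmorph_sum; apply: eq_bigr => j _; rewrite !mxE -(tnth_nth 0) -mulr_algl rmorphM.
  by congr (_ * _); rewrite -(fmorph_eq_rat (psi k \o in_alg K)).
move/(congr1 (mulmx^~ (invmx (conjugate_matrix psi b)))).
rewrite mulmxK// mul0mx => /rowP/(_ i); rewrite !mxE => /eqP.
by rewrite fmorph_eq0 => /eqP.
Qed.

Lemma det_replace_row (F : comNzRingType) (n : nat) (i : 'I_n) (c : 'rV[F]_n) :
  \det (\matrix_(k, l) (if k == i then c 0 l else (k == l)%:R)) = c 0 i.
Proof.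
rewrite (expand_det_col _ i) (bigD1 i)//= big1 ?addr0 => [|k ki]; last first.
  by rewrite mxE (negPf ki) mul0r.
rewrite mxE eqxx /cofactor addnn -mul2n exprM sqrrN expr1n expr1n mul1r.
rewrite [X in \det X](_ : _ = 1%:M) ?det1 ?mulr1//.
apply/matrixP => k l; rewrite !mxE eq_sym (negPf (neq_lift i k)).
by rewrite (inj_eq (@lift_inj _ i)).
Qed.

Lemma tuple_disc_int (K : fieldExtType rat) (L : numFieldType)
    (psi : 'I_(\dim {:K}) -> {rmorphism K -> L}) (z : K) (b : (\dim {:K}).-tuple K) :
  injective (fun k => psi k z) -> (forall i, ring_of_integers K (tnth b i)) ->
  exists m : int, tuple_disc b = m%:~R.
Proof.
move=> zI bO.
have trO i j : exists m : int, field_trace (tnth b i * tnth b j) = m%:~R.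
  by apply: (integral_trace_int zI); apply: integral_mul; apply: bO.
pose N := \matrix_(i, j) sval (cid (trO i j)).
exists (\det N); rewrite /tuple_disc -det_map_mx; congr (\det _).
by apply/matrixP => i j; rewrite !mxE; case: cid.
Qed.

(* A basis of integers with |discriminant| minimal is an integral basis: if x    *)
(* had a coordinate t at b_i with fractional part f > 0, replacing b_i by     *)
(* x - floor(t) b_i would multiply the discriminant by f^2 < 1.               *)
Lemma integral_basis_exists (K : fieldExtType rat) (L : numFieldType)
    (psi : 'I_(\dim {:K}) -> {rmorphism K -> L}) (z : K) :
  injective (fun k => psi k z) -> exists b : (\dim {:K}).-tuple K, integral_basis b.
Proof.
move=> zI.
pose P (N : nat) := `[< exists b : (\dim {:K}).-tuple K,
  [/\ forall i, ring_of_integers K (tnth b i), basis_of {:K} b &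
      `|tuple_disc b| = N%:R] >].
have intN b : (forall i, ring_of_integers K (tnth b i)) ->
    exists N : nat, `|tuple_disc b| = N%:R.
  move=> bO; have [m ->] := tuple_disc_int zI bO.
  by exists `|m|%N; rewrite -intr_norm -[in LHS]abszE.
have exP : exists N, P N.
  (* Integer multiples of an arbitrary rational basis give a first basis of integers, so the minimum
     is over a nonempty set. *)
  pose a i := sval (cid2 (integral_multiple (tnth (vbasis {:K}) i))).
  have aP i : a i != 0 /\ ring_of_integers K (tnth (vbasis {:K}) i *~ a i).
    by rewrite /a; case: cid2.
  pose b := [tuple tnth (vbasis {:K}) i *~ a i | i < \dim {:K}].
  have bO i : ring_of_integers K (tnth b i) by rewrite tnth_mktuple; exact: (aP i).2.
  have [N bN] := intN b bO; exists N; apply/asboolP; exists b; split=> //.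
  rewrite (tuple_disc_basis _ zI).
  rewrite (@tuple_disc_change _ _ _ _ (vbasis {:K}) _ (diag_mx (\row_i (a i)%:~R)) zI).
    rewrite mulf_neq0 ?expf_neq0 -?(tuple_disc_basis _ zI) ?vbasisP//.
    by rewrite det_diag; apply/prodf_neq0 => i _; rewrite mxE intr_eq0 (aP i).1.
  move=> i; rewrite tnth_mktuple (bigD1 i)//= big1 ?addr0 => [|j ji].
    by rewrite !mxE eqxx mulr1n scaler_int.
  by rewrite !mxE eq_sym (negPf ji) mulr0n scale0r.
have [N /asboolP[b [bO bB bN]] Nmin] := ex_minnP exP.
exists b; split=> //; apply/seteqP; split=> x; last first.
  move=> [c ->]; apply: (big_ind (integralOver (intr : int -> K))).
  - exact: mxpoly.integral0.
  - exact: integral_add.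
  - move=> i _; rewrite -mulrzr; apply: integral_mul; first exact: bO.
    exact: integral_id.
move=> xO.
suff coordZ i : exists m : int, coord b i x = m%:~R.
  exists (fun i => sval (cid (coordZ i))); rewrite {1}(basis_expansion x bB).
  by apply: eq_bigr => i _; case: cid => m /= ->; rewrite scaler_int.
pose f := Num.floor (coord b i x).
pose y := x - tnth b i *~ f.
have yi : coord b i y = coord b i x - f%:~R.
  rewrite linearB /= -scaler_int linearZ /= (tnth_nth 0).
  by rewrite coord_free ?(basis_free bB)// eqxx mulr1.
have := floor_itv (coord b i x); rewrite -/f => /andP[fle flt].
have [->|yi0] := eqVneq (coord b i x) f%:~R; first by exists f.
exfalso.
pose b' := [tuple if k == i then y else tnth b k | k < \dim {:K}].
have b'O k : ring_of_integers K (tnth b' k).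
  rewrite tnth_mktuple; case: eqP => _; last exact: bO.
  apply: integral_sub => //; rewrite -mulrzr; apply: integral_mul; first exact: bO.
  exact: integral_id.
pose Q := \matrix_(k, l) (if k == i then passmx.rVof b y 0 l else (k == l)%:R).
have b'E k : tnth b' k = \sum_l Q k l *: tnth b l.
  rewrite tnth_mktuple; case: (eqVneq k i) => [->|ki].
    rewrite {1}(basis_expansion y bB); apply: eq_bigr => l _.
    by rewrite !mxE eqxx.
  rewrite (bigD1 k)//= big1 ?addr0 => [|l lk]; rewrite !mxE (negPf ki).
    by rewrite eqxx scale1r.
  by rewrite eq_sym (negPf lk) scale0r.
have disc' := tuple_disc_change zI b'E.
rewrite det_replace_row mxE yi in disc'.
have [N' b'N] := intN b' b'O.
have t0 : 0 < coord b i x - f%:~R by rewrite subr_gt0 lt_neqAle eq_sym yi0.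
have t1 : coord b i x - f%:~R < 1 by rewrite ltrBlDl -intrD1.
have N0 : 0 < `|tuple_disc b| by rewrite normr_gt0 -(tuple_disc_basis _ zI).
have : (N <= N')%N.
  apply: Nmin; apply/asboolP; exists b'; split=> //.
  rewrite (tuple_disc_basis _ zI) disc' mulf_neq0 ?expf_neq0 ?(lt0r_neq0 t0)//.
  by rewrite -normr_gt0.
apply/negP; rewrite -ltnNge -(ltr_nat rat) -b'N -bN disc' normrM.
by rewrite gtr_pMl// normrX gtr0_norm// exprn_ilt1// ltW.
Qed.

(** * The trace form and the successive minima *)

Definition normsq (R : realType) (x : R[i]) : R :=
  complex.Re x ^+ 2 + complex.Im x ^+ 2.

Lemma normsq_ge0 (R : realType) (x : R[i]) : 0 <= normsq x.
Proof. by rewrite addr_ge0 ?sqr_ge0. Qed.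

Lemma normsqM (R : realType) (x y : R[i]) : normsq (x * y) = normsq x * normsq y.
Proof. by case: x y => [a b] [c d]; rewrite /normsq /=; ring. Qed.

Definition T2 (R : realType) (K : fieldExtType rat) (n : nat)
    (psi : 'I_n -> {rmorphism K -> R[i]}) (x : K) : R :=
  \sum_k normsq (psi k x).

Lemma T2M (R : realType) (K : fieldExtType rat) (n : nat)
    (psi : 'I_n -> {rmorphism K -> R[i]}) (x y : K) :
  T2 psi (x * y) <= T2 psi x * T2 psi y.
Proof.
rewrite /T2 mulr_suml; apply: ler_sum => k _; rewrite rmorphM normsqM.
rewrite ler_wpM2l ?normsq_ge0// (bigD1 k)//= lerDl.
by apply: sumr_ge0 => l _; exact: normsq_ge0.
Qed.

(** The real part of [V] times its conjugate transpose, kept over [R] so that reduction applies to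
    it. *)
Definition gram (R : realType) (m n : nat) (V : 'M[R[i]]_(m, n)) : 'M[R]_m :=
  map_mx (@complex.Re R) V *m (map_mx (@complex.Re R) V)^T +
  map_mx (@complex.Im R) V *m (map_mx (@complex.Im R) V)^T.

Lemma qform_gram (R : realType) (m n : nat) (V : 'M[R[i]]_(m, n)) (v : 'rV[R]_m) :
  qform (gram V) v = \sum_k normsq ((map_mx (real_complex R) v *m V) 0 k).
Proof.
have part (A : 'M[R]_(m, n)) :
    (v *m (A *m A^T) *m v^T) 0 0 = \sum_k ((v *m A) 0 k) ^+ 2.
  rewrite mulmxA -mulmxA -trmx_mul mxE.
  by apply: eq_bigr => k _; rewrite !mxE expr2.
rewrite /qform /gram mulmxDr mulmxDl mxE !part -big_split /=.
apply: eq_bigr => k _; rewrite /normsq; congr (_ ^+ 2 + _ ^+ 2).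
  rewrite !mxE (raddf_sum (@complex.Re R)); apply: eq_bigr => i _.
  by rewrite !mxE; case: (V i k) => a b /=; rewrite mul0r subr0.
rewrite !mxE (raddf_sum (@complex.Im R)); apply: eq_bigr => i _.
by rewrite !mxE; case: (V i k) => a b /=; rewrite mul0r addr0.
Qed.

Lemma T2_gram (R : realType) (K : fieldExtType rat) (n : nat)
    (psi : 'I_n -> {rmorphism K -> R[i]}) (b : (\dim {:K}).-tuple K) (x : K) :
  basis_of {:K} b ->
  T2 psi x = qform (gram (conjugate_matrix psi b)) (map_mx ratr (passmx.rVof b x)).
Proof.
move=> bB; rewrite qform_gram; apply: eq_bigr => k _; congr normsq.
rewrite -map_mx_comp (_ : map_mx _ _ = map_mx ratr (passmx.rVof b x)).
  by rewrite -(conjugates_expansion psi x bB) mxE.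
by apply: eq_map_mx => q /=; exact: (fmorph_eq_rat (real_complex R \o ratr)).
Qed.

Lemma posdef_gram (R : realType) (n : nat) (V : 'M[R[i]]_n) :
  V \in unitmx -> posdef (gram V).
Proof.
move=> Vu; split; first by rewrite linearD /= !trmx_mul !trmxK.
move=> v v0; rewrite qform_gram lt_neqAle sumr_ge0 ?andbT => [|k _]; last first.
  exact: normsq_ge0.
apply: contraNneq v0 => /esym/eqP; rewrite psumr_eq0 => [/allP vV|k _]; last first.
  exact: normsq_ge0.
have : map_mx (real_complex R) v *m V = 0.
  apply/rowP => k; rewrite [RHS]mxE.
  have := vV k (mem_index_enum k); rewrite /= /normsq paddr_eq0 ?sqr_ge0//.
  by rewrite !sqrf_eq0 => re_im; apply/eqP; rewrite eq_complex.
move/(congr1 (mulmx^~ (invmx V))); rewrite mulmxK// mul0mx => v0.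
apply/eqP/rowP => i; have /rowP/(_ i) := v0; rewrite !mxE => /eqP.
by rewrite fmorph_eq0 => /eqP.
Qed.

Definition all_embeddings (R : realType) (K : fieldExtType rat) (r s : nat)
    (E : arch_embeddings R K r s) (k : 'I_(\dim {:K})) : {rmorphism K -> R[i]} :=
  embedding E (cast_ord (dim_embeddings E) k).

Lemma all_embeddings_generic (R : realType) (K : fieldExtType rat) (r s : nat)
    (E : arch_embeddings R K r s) :
  exists z, injective (fun k => all_embeddings E k z).
Proof.
have [z [genK _]] := number_field_generator K; exists z => k l kl.
apply: (@cast_ord_inj _ _ (dim_embeddings E)); apply: (@embedding_inj _ _ _ _ E).
exact: embedding_eq genK kl.
Qed.

Lemma sum_all_embeddings (R : realType) (K : fieldExtType rat) (r s : nat)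
    (E : arch_embeddings R K r s) (F : {rmorphism K -> R[i]} -> R) :
  \sum_k F (all_embeddings E k) =
    \sum_i F (embedding E (lshift (s + s) i)) +
    \sum_j (F (embedding E (rshift r (lshift s j))) +
            F (embedding E (rshift r (rshift s j)))).
Proof.
transitivity (\sum_k F (embedding E k)); last by rewrite !big_split_ord big_split.
rewrite [RHS](reindex (cast_ord (dim_embeddings E))) //=.
by exists (cast_ord (esym (dim_embeddings E))) => k _; rewrite ?cast_ordK ?cast_ordKV.
Qed.

(** Real embeddings contribute equally to both sides; a nonreal pair counts twice in [T2] and once
    in the Euclidean length. *)
Lemma euclidean_le_T2 (R : realType) (K : fieldExtType rat) (r s : nat)
    (E : arch_embeddings R K r s) (x : K) :
  \sum_j (arch_map E x) 0 j ^+ 2 <= T2 (all_embeddings E) x.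
Proof.
have [eR eC eCc] := embeddingP E.
rewrite /T2 (sum_all_embeddings E (fun f => normsq (f x))) !big_split_ord /=.
apply: lerD.
  apply: ler_sum => i _; rewrite /arch_map row_mxEl mxE eR /normsq /=.
  by rewrite expr0n addr0.
rewrite -big_split; apply: ler_sum => j _.
rewrite /arch_map !row_mxEr row_mxEl !mxE eC eCc.
by rewrite /normsq lerDl addr_ge0 ?sqr_ge0.
Qed.

(** A real linear relation between the lattice vectors holds in each embedding and its conjugate,
    hence between the rows of the invertible conjugate matrix. *)
Lemma arch_matrix_free (R : realType) (K : fieldExtType rat) (r s : nat)
    (E : arch_embeddings R K r s) (b : (\dim {:K}).-tuple K) :
  basis_of {:K} b -> row_free (\matrix_i arch_map E (tnth b i)).
Proof.
move=> bB; have [eR eC eCc] := embeddingP E.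
have [z zI] := all_embeddings_generic E.
apply: inj_row_free => v vA.
have col j : \sum_i v 0 i * arch_map E (tnth b i) 0 j = 0.
  have /rowP/(_ j) := vA; rewrite !mxE => vAj.
  by rewrite -[RHS]vAj; apply: eq_bigr => i _; congr (_ * _); rewrite [RHS]mxE.
have reC i : \sum_k v 0 k * real_emb E i (tnth b k) = 0.
  rewrite -[RHS](col (lshift _ i)); apply: eq_bigr => k _.
  by rewrite /arch_map row_mxEl mxE.
have ReC j : \sum_k v 0 k * complex.Re (cplx_emb E j (tnth b k)) = 0.
  rewrite -[RHS](col (rshift _ (lshift _ j))); apply: eq_bigr => k _.
  by rewrite /arch_map row_mxEr row_mxEl mxE.
have ImC j : \sum_k v 0 k * complex.Im (cplx_emb E j (tnth b k)) = 0.
  rewrite -[RHS](col (rshift _ (rshift _ j))); apply: eq_bigr => k _.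
  by rewrite /arch_map !row_mxEr mxE.
have : map_mx (real_complex R) v *m conjugate_matrix (all_embeddings E) b = 0.
  apply/rowP => l; rewrite [RHS]mxE; apply/eqP; rewrite eq_complex.
  rewrite mxE (raddf_sum (@complex.Re R)) (raddf_sum (@complex.Im R)) /=.
  pose psi := all_embeddings E l.
  rewrite (eq_bigr (fun k => v 0 k * complex.Re (psi (tnth b k)))); last first.
    by move=> k _; rewrite !mxE -/psi; case: (psi _) => x y /=; rewrite mul0r subr0.
  rewrite [X in _ && (X == _)]
    (eq_bigr (fun k => v 0 k * complex.Im (psi (tnth b k)))); last first.
    by move=> k _; rewrite !mxE -/psi; case: (psi _) => x y /=; rewrite mul0r addr0.
  rewrite /psi /all_embeddings; move: (cast_ord _ l) => {psi}l.
  case: (split_ordP l) => [i ->|l' ->].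
    under eq_bigr do rewrite eR /=; rewrite reC eqxx /=.
    by under eq_bigr do rewrite eR /= mulr0; rewrite big1 ?eqxx.
  case: (split_ordP l') => [j ->|j ->].
    under eq_bigr do rewrite eC; rewrite ReC eqxx /=.
    by under eq_bigr do rewrite eC; rewrite ImC eqxx.
  have conjE (w : R[i]) :
      complex.Re (conjc w) = complex.Re w /\ complex.Im (conjc w) = - complex.Im w.
    by case: w.
  under eq_bigr do rewrite eCc (conjE _).1; rewrite ReC eqxx /=.
  by under eq_bigr do rewrite eCc (conjE _).2 mulrN; rewrite sumrN ImC oppr0 eqxx.
move/(congr1 (mulmx^~ (invmx (conjugate_matrix (all_embeddings E) b)))).
rewrite mulmxK ?(conjugate_matrix_unit bB zI)// mul0mx => v0.
apply/rowP => i; have /rowP/(_ i) := v0; rewrite !mxE => /eqP.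
by rewrite fmorph_eq0 => /eqP.
Qed.

Lemma det_gram_conjugates (R : realType) (K : fieldExtType rat) (r s : nat)
    (E : arch_embeddings R K r s) (b : (\dim {:K}).-tuple K) :
  \det (gram (conjugate_matrix (all_embeddings E) b)) = `|ratr (tuple_disc b)|.
Proof.
have [z zI] := all_embeddings_generic E.
have [eR eC eCc] := embeddingP E.
set V := conjugate_matrix _ b.
have VE : map_mx (real_complex R) (gram V) = V *m (map_mx conjc V)^T.
  apply/matrixP => i j; rewrite !mxE; apply/eqP; rewrite eq_complex /=.
  rewrite (raddf_sum (@complex.Re R)) (raddf_sum (@complex.Im R)) /=.
  apply/andP; split; apply/eqP.
    rewrite -big_split; apply: eq_bigr => k _; rewrite !mxE.
    case: (all_embeddings E k (tnth b i)) => x y.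
    by case: (all_embeddings E k (tnth b j)) => x' y' /=; ring.
  (* The imaginary parts cancel between conjugate embeddings and vanish at real ones. *)
  pose F (f : {rmorphism K -> R[i]}) := complex.Im (f (tnth b i) * conjc (f (tnth b j))).
  rewrite -[LHS](_ : \sum_k F (all_embeddings E k) = 0); last first.
    rewrite sum_all_embeddings !big1 ?addr0 // => k _; rewrite /F.
      rewrite eC eC eCc eCc.
      case: (cplx_emb E k (tnth b i)) => x y.
      by case: (cplx_emb E k (tnth b j)) => x' y' /=; ring.
    by rewrite !eR /=; ring.
  by apply: eq_bigr => k _; rewrite !mxE.
have := congr1 determinant VE; rewrite det_map_mx det_mulmx det_tr det_map_mx /=.
have := tuple_disc_conjugates b zI; rewrite -/V.
rewrite -(fmorph_eq_rat (real_complex R \o ratr)) /=.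
case: (\det V) => x y; move: (ratr _) (\det (gram V)) => q g.
move=> [-> xy0] [-> _].
(* The discriminant (x + iy)^2 is real, so det V is real or purely imaginary, and |det V|^2 is the
   absolute value of its square. *)
have /eqP : x * y = 0 by move: xy0; lra.
rewrite mulf_eq0 => /orP[] /eqP->.
  have -> : 0 * 0 - y * y = - y ^+ 2 by ring.
  by rewrite normrN ger0_norm ?sqr_ge0//; ring.
have -> : x * x - 0 * 0 = x ^+ 2 by ring.
by rewrite ger0_norm ?sqr_ge0//; ring.
Qed.

(** * Products of reduced basis elements and the final bound *)

Lemma rVof_change (K : fieldExtType rat) (b a : (\dim {:K}).-tuple K)
    (P : 'M[rat]_(\dim {:K})) (x : K) :
  basis_of {:K} b -> basis_of {:K} a ->
  (forall i, tnth a i = \sum_j P i j *: tnth b j) ->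
  passmx.rVof b x = passmx.rVof a x *m P.
Proof.
move=> bB aB aE; apply: (can_inj (passmx.vecofK bB)).
rewrite passmx.rVofK// [LHS](basis_expansion x aB) /passmx.vecof.
under [LHS]eq_bigr do rewrite aE scaler_sumr.
rewrite exchange_big /=; apply: eq_bigr => j _; rewrite !mxE scaler_suml -(tnth_nth 0).
by apply: eq_bigr => i _; rewrite !mxE scalerA.
Qed.

(* If y <> 0 were in the kernel of the form, the i0-th coordinate would vanish  *)
(* on y K = K.                                                                *)
Lemma det_product_coord (K : fieldExtType rat) (a : (\dim {:K}).-tuple K)
    (i0 : 'I_(\dim {:K})) :
  basis_of {:K} a -> \det (\matrix_(k, l) coord a i0 (tnth a k * tnth a l)) != 0.
Proof.
move=> aB; apply/det0P => -[v v0 vS].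
pose y := passmx.vecof a v.
have y0 : y != 0 by rewrite passmx.vecof_eq0.
have yE : y = \sum_k v 0 k *: tnth a k.
  by apply: eq_bigr => k _; rewrite (tnth_nth 0).
have ya l : coord a i0 (y * tnth a l) = 0.
  have /rowP/(_ l) := vS; rewrite !mxE => <-; rewrite yE mulr_suml linear_sum.
  by apply: eq_bigr => k _; rewrite -scalerAl linearZ !mxE.
have yx x : coord a i0 (y * x) = 0.
  rewrite (basis_expansion x aB) mulr_sumr linear_sum big1// => l _.
  by rewrite -scalerAr linearZ /= ya mulr0.
have := yx (y^-1 * tnth a i0); rewrite mulrA divff// mul1r (tnth_nth 0).
by rewrite coord_free ?(basis_free aB)// eqxx => /eqP; rewrite oner_eq0.
Qed.

Lemma det_neq0_perm (F : fieldType) (n : nat) (A : 'M[F]_n) :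
  \det A != 0 -> exists s : 'S_n, forall k, A k (s k) != 0.
Proof.
move=> A0; apply: contrapT => no_s; move/eqP: A0; apply.
rewrite /determinant big1// => s _.
have [k /eqP Ak] : exists k, A k (s k) == 0.
  apply: contrapT => nk; apply: no_s; exists s => k.
  by apply/negP => Ak; apply: nk; exists k.
by rewrite (bigD1 k)//= Ak mul0r mulr0.
Qed.

(** With D = n 2^n, this collects the losses in T2 a_k <= D d_k, d_k <= 2^n d_(n-1) and d_(n-1) <=
    D^2 t^2. *)
Definition reduction_constant (n : nat) : nat := (n * 2 ^ n) ^ 3 * 2 ^ n.

Lemma integral_reduced_basis (R : realType) (K : fieldExtType rat) (r s : nat)
    (E : arch_embeddings R K r s) (t : R) :
  (0 < \dim {:K})%N -> 0 <= t -> t ^+ \dim {:K} = `|ratr (Disc K)| ->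
  exists a : (\dim {:K}).-tuple K, basis_of {:K} a /\ forall k,
    ring_of_integers K (tnth a k) /\
    T2 (all_embeddings E) (tnth a k) <= (reduction_constant (\dim {:K}))%:R * t ^+ 2.
Proof.
move=> n_gt0 t0 tn.
have [z zI] := all_embeddings_generic E.
set psi := all_embeddings E in zI *.
have [b [[bB bO] discE]] : exists b : (\dim {:K}).-tuple K,
    integral_basis b /\ Disc K = tuple_disc b.
  have [b0 b0P] := integral_basis_exists zI.
  (* Existence of an integral basis ensures that [Disc] is an actual discriminant and not the
     default value of [xget]. *)
  have : [set tuple_disc b | b in [set b | @integral_basis K b]] (Disc K).
    by apply: (xgetI 0 (ex_intro2 _ _ b0 b0P erefl)).
  by case=> b bP <-; exists b.
rewrite discE in tn.
pose G := gram (conjugate_matrix psi b).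
have Gp : posdef G by apply: posdef_gram; exact: conjugate_matrix_unit bB zI.
have [U [d [uU d0 dle dprod [rowU colU]]]] := reduced_basis Gp.
have uUQ : (map_mx intr U : 'M[rat]_(\dim {:K})) \in unitmx.
  by rewrite unitmxE det_map_mx (rmorph_unit (intr : {rmorphism int -> rat}))// -unitmxE.
pose a := [tuple \sum_j tnth b j *~ U i j | i < \dim {:K}].
have aE i : tnth a i = \sum_j (map_mx intr U : 'M[rat]_(\dim {:K})) i j *: tnth b j.
  by rewrite tnth_mktuple; apply: eq_bigr => j _; rewrite mxE scaler_int.
have aB : basis_of {:K} a.
  rewrite (tuple_disc_basis _ zI) (tuple_disc_change zI aE).
  apply: mulf_neq0; last by rewrite -(tuple_disc_basis _ zI).
  by rewrite expf_neq0// -unitfE -unitmxE.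
have aO i : ring_of_integers K (tnth a i).
  by rewrite bO tnth_mktuple; exists (fun j => U i j).
have T2E x : T2 psi x = qform G (map_mx ratr (passmx.rVof a x) *m intmx R U).
  rewrite (T2_gram psi x bB) (rVof_change x bB aB aE) map_mxM -map_mx_comp.
  by congr (qform G (_ *m _)); apply: eq_map_mx => m /=; exact: ratr_int.
pose D : R := (\dim {:K} * 2 ^ \dim {:K})%:R.
have D1 : 1 <= D by rewrite ler1n muln_gt0 n_gt0 expn_gt0.
have pow_le k : (k <= \dim {:K})%N -> 2 ^+ k <= (2 ^ \dim {:K})%:R :> R.
  by move=> kn; rewrite natrX ler_eXn2l ?ltr1n.
have T2a k : T2 psi (tnth a k) <= D * d k.
  have -> : T2 psi (tnth a k) = qform G (intmx R (row k U)).
    rewrite T2E (tnth_nth 0) passmx.rVofE// map_delta_mx -rowE /intmx.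
    by rewrite map_row.
  apply: (le_trans (rowU k)).
  apply: (@le_trans _ _ (\sum_(j < \dim {:K}) (2 ^ \dim {:K})%:R * d k)).
    rewrite big_mkcond /=; apply: ler_sum => j _; case: ifP => [jk|_].
      apply: (le_trans (dle _ _ jk)); rewrite ler_wpM2r ?(ltW (d0 k))//.
      by apply: pow_le; rewrite ltnW.
    by rewrite mulr_ge0 ?ler0n ?ltW.
  by rewrite sumr_const card_ord -[leLHS]mulr_natl mulrA -natrM.
have last_lt : ((\dim {:K}).-1 < \dim {:K})%N by rewrite prednK.
pose l0 := Ordinal last_lt.
have T2_last x : ring_of_integers K x -> coord a l0 x != 0 -> d l0 <= T2 psi x.
  rewrite bO => -[c xE] x0.
  have [y yE] : exists y : 'rV[int]_(\dim {:K}), passmx.rVof a x = map_mx intr y.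
    (* Coordinates in the reduced basis stay integral because [U] is invertible over the integers; a
       nonzero last coordinate then has square at least 1. *)
    exists (\row_i c i *m invmx U).
    have bx : passmx.rVof b x = map_mx intr (\row_i c i).
      apply: (can_inj (passmx.vecofK bB)); rewrite passmx.rVofK// xE.
      by apply: eq_bigr => i _; rewrite !mxE scaler_int (tnth_nth 0).
    rewrite map_mxM -bx (rVof_change x bB aB aE) -mulmxA -map_mxM mulmxV//.
    by rewrite map_mx1 mulmx1.
  have x0E : coord a l0 x = (y 0 l0)%:~R.
    by rewrite passmx.coord_rVof yE mxE.
  rewrite T2E yE -map_mx_comp (_ : map_mx _ y = intmx R y); last first.
    by apply: eq_map_mx => m /=; exact: ratr_int.
  apply: (le_trans _ (colU l0 _ _)); last first.
    by move=> j; rewrite ltnNge -ltnS prednK// ltn_ord.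
  rewrite ler_pMr// mxE -rmorphXn ler1z -gtz0_ge1 lt_neqAle sqr_ge0 andbT eq_sym.
  by rewrite expf_eq0 /=; apply: contraNneq x0 => y0; rewrite x0E y0.
have [p pP] := det_neq0_perm (det_product_coord l0 aB).
have d_last k : d l0 <= D ^+ 2 * (d k * d (p k)).
  have := pP k; rewrite mxE => /T2_last le1.
  apply: (le_trans (le1 _)); first by apply: integral_mul; apply: aO.
  apply: (le_trans (T2M _ _ _)).
  apply: (@le_trans _ _ ((D * d k) * (D * d (p k)))); last first.
    by rewrite expr2 mulrACA.
  by apply: ler_pM => //; apply: sumr_ge0 => ? _; exact: normsq_ge0.
have d_le : d l0 <= D ^+ 2 * t ^+ 2.
  rewrite -(@ler_pXn2r _ (\dim {:K})) ?nnegrE ?(ltW (d0 _))//; last first.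
    by rewrite mulr_ge0 ?sqr_ge0.
  (* Since p is a permutation, the d_k and the d_(p k) have the same product |Disc K| = t^n. *)
  have -> : (D ^+ 2 * t ^+ 2) ^+ \dim {:K} = \prod_k (D ^+ 2 * (d k * d (p k))).
    rewrite big_split /= prodr_const card_ord big_split /=.
    have -> : \prod_k d (p k) = \prod_k d k by rewrite [RHS](reindex_inj (@perm_inj _ p)).
    rewrite dprod det_gram_conjugates -tn.
    by rewrite exprMn; congr (_ * _); rewrite exprAC expr2.
  have -> : d l0 ^+ \dim {:K} = \prod_(k < \dim {:K}) d l0.
    by rewrite prodr_const card_ord.
  by apply: ler_prod => k _; rewrite (ltW (d0 l0)) d_last.
exists a; split=> // k; split; first exact: aO.
apply: (le_trans (T2a k)).
apply: (@le_trans _ _ (D * ((2 ^ \dim {:K})%:R * (D ^+ 2 * t ^+ 2)))).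
  rewrite ler_wpM2l ?(le_trans ler01 D1)//.
  apply: (@le_trans _ _ ((2 ^ \dim {:K})%:R * d l0)); last by rewrite ler_wpM2l.
  have kl : (k <= l0)%N by rewrite -ltnS prednK.
  apply: (le_trans (dle _ _ kl)); rewrite ler_wpM2r ?(ltW (d0 _))//.
  by apply: pow_le; exact: ltnW.
have -> : (reduction_constant (\dim {:K}))%:R = D ^+ 3 * (2 ^ \dim {:K})%:R :> R.
  by rewrite /reduction_constant natrM natrX.
rewrite le_eqVlt; apply/orP; left; apply/eqP.
by generalize D ((2 ^ \dim {:K})%:R : R) => u v; ring.
Qed.

Lemma reduction_constant_ge1 (n : nat) : (0 < n)%N -> (0 < reduction_constant n)%N.
Proof. by move=> n0; rewrite muln_gt0 expn_gt0 muln_gt0 n0 !expn_gt0. Qed.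

Unset Implicit Arguments.

Theorem theorem1p6 (R : realType) (n : nat) (hn : (0 < n)%N) :
  exists c : R, 0 < c /\
    forall (K : fieldExtType rat) (hK : \dim {:K} = n) (r s : nat)
        (E : arch_embeddings R K r s),
      let bound := c * `|ratr (Disc K)| `^ n%:R^-1 in
      (successive_minimum (arch_lattice E) n <= bound%:E)%E /\
      has_indep_le (arch_lattice E) n bound.
Proof.
have c0 := reduction_constant_ge1 hn; set c := reduction_constant n in c0.
exists c%:R; split; first by rewrite ltr0n.
move=> K hK r s E bound.
suff indep : has_indep_le (arch_lattice E) n bound.
  by split=> //; apply: ereal_inf_lbound; exists bound.
rewrite {}/bound {}/c in c0 *; subst n.
set t := `|ratr (Disc K)| `^ (\dim {:K})%:R^-1.
have t0 : 0 <= t by exact: powR_ge0.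
have tn : t ^+ \dim {:K} = `|ratr (Disc K)|.
  rewrite -powR_mulrn// /t -powRrM mulVf ?powRr1//.
  by rewrite pnatr_eq0 -lt0n.
have [a [aB aP]] := integral_reduced_basis E hn t0 tn.
exists (\matrix_i arch_map E (tnth a i)); split; first exact: arch_matrix_free.
move=> i; rewrite rowK; have [aO aT] := aP i; split; first by exists (tnth a i).
rewrite /euclidean_length -(ler_pXn2r (n := 2)) ?nnegrE ?sqrtr_ge0//; last first.
  by rewrite mulr_ge0 ?ler0n.
rewrite sqr_sqrtr; last by apply: sumr_ge0 => j _; exact: sqr_ge0.
apply: (le_trans (euclidean_le_T2 E _)); apply: (le_trans aT).
(* The constant bounds the squared length; being at least 1, it is at most its own square, so it
   also bounds the length. *)
by rewrite exprMn ler_wpM2r ?sqr_ge0// expr2 ler_peMr ?ler0n ?ler1n.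
Qed.
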